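(* Let $(M,F)$ be a compact, connected, $C^\infty$, reversible Finsler manifold and let $f:M\to\mathbb{R}$ be a ($dv_F$-integrable) real function with $\int_M f\,dv_F=0$. Then a weak solution $u\in H_1^2(M)$ of the Dirichlet equation $\Delta u=f$ can be approximated by $C^\infty$ functions with compact support on $M$; that is, for every weak solution $u\in H_1^2(M)$ of $\Delta u=f$ there is a sequence $(u_j)$ in $D(M)$ with $\|u_j-u\|_{H_1^2(M)}\to 0$.
   Context: Finsler structures. Let $M$ be an $n$-dimensional $C^\infty$ manifold. A Finsler structure on $M$ is a function $F:TM\to[0,\infty)$ such that (1) $F$ is $C^\infty$ on $TM\setminus 0$ (the tangent bundle minus the zero section); (2) $F(x,\lambda y)=\lambda F(x,y)$ for all $\lambda>0$; (3) the $n\times n$ matrix $g_{ij}=\frac12 [F^2]_{y^iy^j}$ is positive definite at every point of $TM\setminus 0$. $F$ is reversible if $F(x,-y)=F(x,y)$ for all $(x,y)\in TM$. The length of a piecewise $C^\infty$ curve $\sigma:[a,b]\to M$ is $\int_a^b F(\sigma,\dot\sigma)\,dt$, and $d(p,x)$ is the infimum of the lengths of piecewise $C^\infty$ curves from $p$ to $x$. Volume. $dv_F$ denotes the Busemann volume form: if $\{b_i\}$ is a basis of $T_xM$ with dual basis $\{\theta^i\}$, then $dv_F=\sigma_F(x)\,\theta^1\wedge\cdots\wedge\theta^n$ with $\sigma_F(x)=\mathrm{vol}(B^n(1))/\mathrm{vol}\{(y^i)\in\mathbb{R}^n: F(x,y^ib_i)<1\}$, where $\mathrm{vol}$ is Euclidean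 volume and $B^n(1)$ is the Euclidean unit ball. For open $U\subset M$, $\mathrm{vol}_F(U)=\int_U dv_F$. Osculating Riemannian metric. In local coordinates put $K^{ij}(x)=(n+2)\frac{\int_I y^iy^j\,dy}{\int_I dy}$ with $I=\{y=y^i\partial_{x^i}\in T_xM: F(x,y)\le 1\}$. This is a symmetric positive definite contravariant 2-tensor; the osculating Riemannian metric $K$ is the Riemannian metric on $M$ whose inverse has components $K^{ij}$. Let $\nabla$ be the Levi-Civita connection of $(M,K)$, and for a function $\phi$ let $|\nabla^l\phi|^2=K^{i_1j_1}\cdots K^{i_lj_l}\nabla_{i_1}\cdots\nabla_{i_l}\phi\,\nabla_{j_1}\cdots\nabla_{j_l}\phi$, with $|\nabla^0\phi|=|\phi|$. Laplacian. $\Delta$ is the (mean-value) Finsler Laplacian of Centore: for smooth $\phi:M\to\mathbb{R}$ and $x\in M$, $\Delta\phi(x)=\lim_{r\to0^+}\frac{2(n+2)}{r^2}\Big(\frac{1}{\mathrm{vol}_F(B_x(r))}\int_{B_x(r)}\phi\,dv_F-\phi(x)\Big)$, where $B_x(r)=\{z: d(x,z)<r\}$. It exists and is a linear second-order differential operator of the form $\Delta\phi=K^{ij}\frac{\partial^2\phi}{\partial x^i\partial x^j}+$ lower order terms. Weak solutions. A linear differential operator of order $2m$ is written $A(u)=\sum_{l=0}^{2m}a_l^{\alpha_1\cdots\alpha_l}\nabla_{\alpha_1\cdots\alpha_l}u$ with $a_l$ an $l$-tensor; its adjoint is $A^*(\phi)=\sum_{l=0}^{2m}(-1)^l\nabla_{\alpha_1\cdots\alpha_l}(\phi\,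 a_l^{\alpha_1\cdots\alpha_l})$. A function $u$ is a weak solution of $A(u)=f$ if $\int_M u\,A^*(\phi)\,dv_F=\int_M f\phi\,dv_F$ for all $\phi\in D(M)$. Sobolev spaces. $L^p(M)$ is the space of measurable $f:M\to\mathbb{R}$ with $\|f\|_p=(\int_M|f|^p\,dv_F)^{1/p}<\infty$. For real $p\ge1$ and an integer $k\ge 0$, $C_k^p$ is the vector space of real $C^\infty$ functions $\phi$ on $M$ with $|\nabla^l\phi|\in L^p(M)$ for all $0\le l\le k$, and $H_k^p(M)$ is the completion of $C_k^p$ with respect to the norm $\|\phi\|_{H_k^p(M)}=\sum_{l=0}^k\|\nabla^l\phi\|_p$, where $\|\nabla^l\phi\|_p=(\int_M|\nabla^l\phi|^p\,dv_F)^{1/p}$. $D(M)$ is the space of real $C^\infty$ functions with compact support on $M$. *)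

(* Defs.v *)
From mathcomp Require Import all_boot all_order all_algebra.
From mathcomp Require Import all_classical all_reals all_analysis.

Set Implicit Arguments.
Unset Strict Implicit.
Unset Printing Implicit Defensive.

Import Order.TTheory GRing.Theory Num.Theory.
Import numFieldNormedType.Exports.

Local Open Scope classical_set_scope.
Local Open Scope ring_scope.

Section Euclidean.
Context {R : realType}.

Definition pder (m : nat) (k : 'I_m) (f : 'rV[R]_m -> R) (x : 'rV[R]_m) : R :=
  'D_(delta_mx 0 k) f x.

(* f is C^oo on the open set U: all iterated partial derivatives exist and are
   continuous at the points of U. *)
Definition smooth_on (m : nat) (U : set 'rV[R]_m) (f : 'rV[R]_m -> R) : Prop :=
  forall (s : seq 'I_m) (x : 'rV[R]_m), U x ->
    {for x, continuous (foldr (@pder m) f s)} /\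
    forall k : 'I_m, derivable (foldr (@pder m) f s) x (delta_mx 0 k).

(* Lebesgue integral over R^m as an m-fold iterated integral (Fubini-Tonelli).
   It is only applied to Borel functions that are nonnegative, or bounded with
   bounded support. *)
Fixpoint iint (m : nat) : ('rV[R]_m -> \bar R) -> \bar R :=
  match m with
  | 0 => fun g => g 0
  | m'.+1 => fun g => (\int[lebesgue_measure]_t
      iint (fun v : 'rV[R]_m' => g (row_mx (t%:M : 'rV[R]_1) v)))%E
  end.

Definition vol (m : nat) (A : set 'rV[R]_m) : R :=
  fine (iint (fun y => (\1_A y)%:E)).

Definition posdef (m : nat) (A : 'M[R]_m) : Prop :=
  A^T = A /\ forall w : 'rV[R]_m, w != 0 -> 0 < (w *m A *m w^T) 0 0.

End Euclidean.

(* A C^oo manifold of dimension n, given by an atlas indexed by chart_index; the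
   maps chart i and chart_inv i are total, but only their values on chart_dom i
   and on its image are meaningful. *)
Record manifold (R : realType) (n : nat) := Manifold {
  carrier :> ptopologicalType ;
  manifold_hausdorff : hausdorff_space carrier ;
  manifold_second_countable : @second_countable carrier ;
  chart_index : Type ;
  chart_dom : chart_index -> set carrier ;
  chart : chart_index -> carrier -> 'rV[R]_n ;
  chart_inv : chart_index -> 'rV[R]_n -> carrier ;
  chart_at : carrier -> chart_index ;
  chart_at_dom : forall p, chart_dom (chart_at p) p ;
  chart_dom_open : forall i, open (chart_dom i) ;
  chart_cod_open : forall i, open (chart i @` chart_dom i) ;
  chartK : forall i p, chart_dom i p -> chart_inv i (chart i p) = p ;
  chart_continuous : forall i p, chart_dom i p -> {for p, continuous (chart i)} ;
  chart_inv_continuous : forall i x, (chart i @` chart_dom i) x ->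
    {for x, continuous (chart_inv i)} ;
  chart_transition : forall i j (k : 'I_n),
    smooth_on [set x | (chart i @` chart_dom i) x /\ chart_dom j (chart_inv i x)]
              (fun x => chart j (chart_inv i x) 0 k)
}.

Section Finsler.
Context {R : realType} {n : nat} (M : manifold R n).
Implicit Types (i j : chart_index M) (p q : M) (x y : 'rV[R]_n).

Definition chart_cod i : set 'rV[R]_n := chart i @` chart_dom i.

Definition smooth (phi : M -> R) : Prop :=
  forall i, smooth_on (chart_cod i) (phi \o chart_inv i).

Definition test_function (phi : M -> R) : Prop :=
  smooth phi /\ compact (closure [set p | phi p != 0]).

Definition cinf := {phi : M -> R | smooth phi}.

(* T_pM, as the space of derivations at p of the algebra of smooth functions. *)
Definition tangent_space p : set (cinf -> R) := [set v |
  (forall (a : R) (phi psi chi : cinf),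
     (forall q, sval chi q = a * sval phi q + sval psi q) ->
     v chi = a * v phi + v psi) /\
  (forall phi psi chi : cinf,
     (forall q, sval chi q = sval phi q * sval psi q) ->
     v chi = v phi * sval psi p + sval phi p * v psi)].

(* The tangent vector y^k d/dx^k at the point of coordinates x in chart i. *)
Definition tvec i x y : cinf -> R :=
  fun phi => \sum_k y 0 k * pder k (sval phi \o chart_inv i) x.

(* A function on TM; only its values F p v with v in T_pM are meaningful. *)
Definition tangent_fun := M -> (cinf -> R) -> R.

Implicit Type F : tangent_fun.

Definition local_expr F i x y : R := F (chart_inv i x) (tvec i x y).

Definition fundamental_tensor F i x y : 'M[R]_n :=
  \matrix_(k, l)
    (2^-1 * pder l (pder k (fun z => local_expr F i x z ^+ 2)) y).

Record finsler F : Prop := Finsler {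
  finsler_ge0 : forall p v, tangent_space p v -> 0 <= F p v ;
  finsler_smooth : forall i,
    smooth_on [set z : 'rV[R]_(n + n) | chart_cod i (lsubmx z) /\ rsubmx z != 0]
              (fun z => local_expr F i (lsubmx z) (rsubmx z)) ;
  finsler_homogeneous : forall p v (a : R), tangent_space p v -> 0 < a ->
    F p (fun phi => a * v phi) = a * F p v ;
  finsler_posdef : forall i x y, chart_cod i x -> y != 0 ->
    posdef (fundamental_tensor F i x y)
}.

Definition reversible F : Prop :=
  forall p v, tangent_space p v -> F p (fun phi => - v phi) = F p v.

Section Distance.
Implicit Type c : R -> M.

Definition smooth_curve_on (U : set R) c : Prop :=
  forall t, U t -> {for t, continuous c} /\
    forall i, chart_dom i (c t) -> forall (k : 'I_n) (l : nat),
      derivable (derive1n l (fun s => chart i (c s) 0 k)) t 1.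

(* c is piecewise C^oo on [a, b]: there is a subdivision of [a, b] such that, on
   each closed piece, c is the restriction of a curve that is C^oo on a
   neighbourhood of this piece. *)
Definition piecewise_smooth (a b : R) c : Prop :=
  exists s : seq R, [/\ path <%R a s, last a s = b &
    forall l, (l < size s)%N ->
      let t0 := nth a (a :: s) l in let t1 := nth a s l in
      exists (g : R -> M) (e : R),
        [/\ 0 < e, smooth_curve_on `]t0 - e, t1 + e[ g &
            {in `[t0, t1], c =1 g}]].

(* Its value is arbitrary where c is not differentiable. *)
Definition velocity c (t : R) : cinf -> R := 
  fun phi => derive1 (sval phi \o c) t.

Definition curve_length F (a b : R) c : \bar R :=
  (\int[lebesgue_measure]_(t in `[a, b]) (F (c t) (velocity c t))%:E)%E.

Definition dist F p q : \bar R :=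
  ereal_inf [set L | exists (a b : R) c,
    [/\ piecewise_smooth a b c, c a = p, c b = q & L = curve_length F a b c]].

Definition fball F p (r : R) : set M := [set z | (dist F p z < r%:E)%E].

End Distance.

Section Volume.

Definition busemann_density F i x : R :=
  vol [set y : 'rV[R]_n | \sum_k y 0 k ^+ 2 < 1] /
  vol [set y | local_expr F i x y < 1].

Definition borel := g_sigma_algebraType (@open M).

(* The Borel measure of the density dv_F, that is, the measure given in each
   chart by busemann_density dx; it is unique since M is covered by countably
   many charts. *)
Definition busemann_measure F (mu : {measure set borel -> \bar R}) : Prop :=
  forall i (A : set M), measurable (A : set borel) -> A `<=` chart_dom i ->
    mu A = iint (fun x => (busemann_density F i x *
             \1_[set z | chart_cod i z /\ A (chart_inv i z)] x)%:E).

End Volume.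

Section Osculating.

Definition osculating_inv F i x : 'M[R]_n :=
  let I := [set y | local_expr F i x y <= 1] in
  \matrix_(k, l) ((n + 2)%:R *
    (fine (iint (fun y => (y 0 k * y 0 l * \1_I y)%:E)) / vol I)).

Definition osculating F i x : 'M[R]_n := invmx (osculating_inv F i x).

Definition christoffel F i x (k a b : 'I_n) : R :=
  2^-1 * \sum_l osculating_inv F i x k l *
    (pder a (fun z => osculating F i z b l) x +
     pder b (fun z => osculating F i z a l) x -
     pder l (fun z => osculating F i z a b) x).

(* Components, in a chart, of a tensor field: T lo up x is the component with
   lower indices lo and upper indices up; only the values at index lists of the
   right lengths are meaningful. *)
Definition components := seq 'I_n -> seq 'I_n -> 'rV[R]_n -> R.

(* Levi-Civita covariant derivative; the new lower index comes first. *)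
Definition nabla F i (T : components) : components := fun lo up x =>
  if lo is j :: lo' then
    pder j (T lo' up) x
    - \sum_(s < size lo') \sum_m
        christoffel F i x m j (nth j lo' s) * T (set_nth j lo' s m) up x
    + \sum_(s < size up) \sum_m
        christoffel F i x (nth j up s) j m * T lo' (set_nth j up s m) x
  else 0.

Definition scalar_components (h : 'rV[R]_n -> R) : components :=
  fun _ _ => h.

(* Below, quantities which do not depend on the chart are computed at p in
   chart_at p. *)
Definition nabla_norm F (l : nat) (phi : M -> R) : M -> R := fun p =>
  let i := chart_at p in let x := chart i p in
  let T := iter l (nabla F i) (scalar_components (phi \o chart_inv i)) in
  Num.sqrt (\sum_(I : l.-tuple 'I_n) \sum_(J : l.-tuple 'I_n)
    (\prod_(s < l) osculating_inv F i x (tnth I s) (tnth J s)) *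
    T I [::] x * T J [::] x).

(* a i alpha x is the component alpha in chart i, at the point of coordinates x,
   of a smooth contravariant l-tensor. *)
Definition contravariant_tensor (l : nat)
    (a : chart_index M -> seq 'I_n -> 'rV[R]_n -> R) : Prop :=
  (forall i (alpha : l.-tuple 'I_n), smooth_on (chart_cod i) (a i alpha)) /\
  (forall i j x, chart_cod i x -> chart_dom j (chart_inv i x) ->
    forall beta : l.-tuple 'I_n,
      a j beta (chart j (chart_inv i x)) = \sum_(alpha : l.-tuple 'I_n)
        (\prod_(s < l) pder (tnth alpha s)
           (fun z => chart j (chart_inv i z) 0 (tnth beta s)) x) * a i alpha x).

(* The coefficients of a linear differential operator: a l is an l-tensor. *)
Definition coefficients := nat -> chart_index M -> seq 'I_n -> 'rV[R]_n -> R.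

Definition diff_op F (d : nat) (a : coefficients) (u : M -> R) : M -> R :=
  fun p => let i := chart_at p in let x := chart i p in
  \sum_(l < d.+1) \sum_(alpha : l.-tuple 'I_n) a l i alpha x *
    iter l (nabla F i) (scalar_components (u \o chart_inv i)) alpha [::] x.

Definition adjoint_op F (d : nat) (a : coefficients) (phi : M -> R) : M -> R :=
  fun p => let i := chart_at p in let x := chart i p in
  \sum_(l < d.+1) (-1) ^+ l * \sum_(alpha : l.-tuple 'I_n)
    iter l (nabla F i)
      (fun _ up z => phi (chart_inv i z) * a l i up z) alpha alpha x.

End Osculating.

Section Analysis.
Context (F : tangent_fun) (mu : {measure set borel -> \bar R}).

Definition laplacian (phi : M -> R) (p : M) : R :=
  lim ((2 * (n + 2)%:R / r ^+ 2 *
        ((fine (mu (fball F p r)))^-1 * (\int[mu]_(z in fball F p r) phi z)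
         - phi p)) @[r --> 0^'+]).

Definition weak_solution (d : nat) (a : coefficients) (u f : M -> R) : Prop :=
  forall phi, test_function phi ->
    (\int[mu]_q (u q * adjoint_op F d a phi q)%:E =
     \int[mu]_q (f q * phi q)%:E)%E.

(* u is a weak solution of Delta u = f, where Delta is written as a differential
   operator of order 2; the adjoint does not depend on the way of writing it. *)
Definition weak_laplacian_solution (u f : M -> R) : Prop :=
  exists a : coefficients,
    [/\ forall l, (l <= 2)%N -> contravariant_tensor l (a l),
        forall phi, smooth phi -> laplacian phi =1 diff_op F 2 a phi &
        weak_solution 2 a u f].

Definition sobolev_smooth (k : nat) (r : R) (phi : M -> R) : Prop :=
  smooth phi /\ forall l, (l <= k)%N ->
    (nabla_norm F l phi : borel -> R) \in Lfun mu r%:E.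

Definition sobolev_norm (k : nat) (r : R) (phi : M -> R) : \bar R :=
  (\sum_(l < k.+1) Lnorm mu r%:E (EFin \o (nabla_norm F l phi : borel -> R)))%E.

End Analysis.

End Finsler.

Section Completion.
Context {R : realType} {T : Type}.
Variables (C : (T -> R) -> Prop) (N : (T -> R) -> \bar R).

Definition cauchy_seq (phi : nat -> T -> R) : Prop :=
  (forall k, C (phi k)) /\
  forall e : R, 0 < e -> exists K : nat, forall j k, (K <= j)%N -> (K <= k)%N ->
    (N (phi j \- phi k)%R < e%:E)%E.

(* The completion of the space C of functions for the norm N: its points are the
   equivalence classes of Cauchy sequences of C. *)
Definition completion : set (set (nat -> T -> R)) := [set U |
  exists2 phi, cauchy_seq phi & U = [set psi |
    cauchy_seq psi /\ N (psi k \- phi k) @[k --> \oo] --> 0%E]].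

(* The norm of v - U in the completion. For a representative phi of U,
   N (v - phi k) converges to a limit which does not depend on phi, hence the
   upper limit is a limit, and the infimum is over a singleton. *)
Definition completion_dist (v : T -> R) (U : set (nat -> T -> R)) : \bar R :=
  ereal_inf [set limn_esup (fun k => N (v \- phi k)) | phi in U].

End Completion.

Section Sobolev.
Context {R : realType} {n : nat} (M : manifold R n).
Context (F : tangent_fun M) (mu : {measure set (borel M) -> \bar R}).

Definition sobolev (k : nat) (r : R) : set (set (nat -> M -> R)) :=
  completion (sobolev_smooth F mu k r) (sobolev_norm F mu k r).

Definition sobolev_dist (k : nat) (r : R) (v : M -> R) U : \bar R :=
  completion_dist (sobolev_norm F mu k r) v U.

(* The function u represents the point U of the completion H_k^r(M), through the
   canonical map from H_k^r(M) to L^r(M). *)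
Definition sobolev_fun (r : R) (U : set (nat -> M -> R)) (u : M -> R) : Prop :=
  (u : borel M -> R) \in Lfun mu r%:E /\
  forall phi, U phi ->
    Lnorm mu r%:E (EFin \o (phi j \- u : borel M -> R)) @[j --> \oo] --> 0%E.

End Sobolev.

(* Main.v *)
Require Import Defs.
From mathcomp Require Import all_boot all_order all_algebra.
From mathcomp Require Import all_classical all_reals all_analysis.
Import Order.TTheory GRing.Theory Num.Theory.
Import numFieldNormedType.Exports.

Local Open Scope classical_set_scope.
Local Open Scope ring_scope.

(** A point [U] of [H_1^2(M)] is, by construction, a class of Cauchy sequences
of smooth functions, and on a compact manifold every smooth function has
compact support. So any Cauchy sequence [phi] representing [U] consists of
test functions, and it converges to [U]: the distance from [phi j] to [U] is
the limit of the norms of [phi j - phi k] as [k] grows, which is small for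
large [j] because [phi] is Cauchy. This is the density of a normed space in its
completion ([completion_approx]) together with [smooth_test_function]. *)

(** The upper limit is an infimum of suprema over the neighbourhoods of
infinity, so it is enough that one such neighbourhood carries the bound. *)
Lemma limn_esup_le_near (R : realType) (v : nat -> \bar R) (x : \bar R) :
  (\forall k \near \oo, (v k <= x)%E) -> (limn_esup v <= x)%E.
Proof.
move=> v_le.
apply: (@le_trans _ _ (ereal_sup (v @` [set k | (v k <= x)%E]))).
  by apply: ereal_inf_lbound; exists [set k | (v k <= x)%E].
by apply: ub_ereal_sup => _ [k /= vk <-].
Qed.

Lemma nneg_ereal_cvg0 (R : realType) (v : nat -> \bar R) :
  (forall k, (0 <= v k)%E) ->
  (forall e : R, 0 < e -> \forall k \near \oo, (v k <= e%:E)%E) ->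
  v k @[k --> \oo] --> 0%E.
Proof.
move=> v_ge0 v_small; apply: limn_esup_le_cvg => //.
apply/lee_addgt0Pr => e e_gt0; rewrite add0e.
exact: limn_esup_le_near (v_small e e_gt0).
Qed.

Section Completion.
Context {R : realType} {T : Type}.
Variables (C : (T -> R) -> Prop) (N : (T -> R) -> \bar R).
Hypothesis N_ge0 : forall v, (0 <= N v)%E.

(** The Cauchy condition at equal indices bounds [N (phi k - phi k)], so [phi]
belongs to its own class without computing [N] at [0]. *)
Lemma cauchy_seq_equiv_refl (phi : nat -> T -> R) :
  cauchy_seq C N phi -> N (phi k \- phi k) @[k --> \oo] --> 0%E.
Proof.
move=> [_ phi_cauchy]; apply: nneg_ereal_cvg0 => // e e_gt0.
have [K NK] := phi_cauchy e e_gt0.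
by exists K => // k /= Kk; apply/ltW/NK.
Qed.

Lemma completion_dist_ge0 (v : T -> R) (U : set (nat -> T -> R)) :
  (0 <= completion_dist N v U)%E.
Proof.
apply: le_ereal_inf_tmp => _ [phi _ <-]; apply: limf_esup_ge0 => [|k].
  by move=> [K _ /(_ K (leqnn K))].
exact: N_ge0.
Qed.

(** The infimum that defines the distance to the class is at most the upper
limit computed along [phi] itself, which the Cauchy condition makes small. *)
Lemma completion_approx (U : set (nat -> T -> R)) : completion C N U ->
  exists phi : nat -> T -> R, (forall j, C (phi j)) /\
    completion_dist N (phi j) U @[j --> \oo] --> 0%E.
Proof.
move=> [phi phi_cauchy ->]; have [phiC phi_small] := phi_cauchy.
exists phi; split=> //; apply: nneg_ereal_cvg0 => [j|e e_gt0].
  exact: completion_dist_ge0.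
have [K NK] := phi_small e e_gt0; exists K => // j /= Kj.
apply: (@le_trans _ _ (limn_esup (fun k => N (phi j \- phi k)))).
  apply: ereal_inf_lbound; exists phi => //; split=> //.
  exact: cauchy_seq_equiv_refl.
by apply: limn_esup_le_near; exists K => // k /= Kk; apply/ltW/NK.
Qed.

End Completion.

Lemma smooth_test_function (R : realType) (n : nat) (M : manifold R n)
    (phi : M -> R) : compact [set: M] -> smooth phi -> test_function phi.
Proof.
move=> M_compact phi_smooth; split=> //.
by apply: (subclosed_compact _ M_compact) => //; exact: closed_closure.
Qed.

Lemma sobolev_norm_ge0 (R : realType) (n : nat) (M : manifold R n)
    (F : tangent_fun M) (mu : {measure set (borel M) -> \bar R})
    (k : nat) (r : R) (phi : M -> R) : (0 <= sobolev_norm F mu k r phi)%E.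
Proof. by apply: sume_ge0 => l _; exact: Lnorm_ge0. Qed.

Theorem corollary1 (R : realType) (n : nat) (M : manifold R n)
    (F : tangent_fun M) (mu : {measure set (borel M) -> \bar R})
    (M_compact : compact [set: M]) (M_connected : connected [set: M])
    (F_finsler : finsler F) (F_reversible : reversible F)
    (mu_busemann : busemann_measure F mu)
    (f : M -> R)
    (f_integrable : mu.-integrable setT (EFin \o (f : borel M -> R)))
    (f_mean0 : (\int[mu]_(q in setT) (f q)%:E = 0)%E)
    (U : set (nat -> M -> R)) (u : M -> R)
    (U_sobolev : sobolev F mu 1 2 U) (u_U : sobolev_fun mu 2 U u)
    (u_weak : weak_laplacian_solution F mu u f) :
  exists u_ : nat -> M -> R,
    (forall j, test_function (u_ j)) /\
    sobolev_dist F mu 1 2 (u_ j) U @[j --> \oo] --> 0%E.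
Proof.
have [phi [phi_smooth phi_cvg]] :=
  completion_approx _ _ (sobolev_norm_ge0 R n M F mu 1 2) _ U_sobolev.
exists phi; split=> // j; apply: smooth_test_function => //.
by have [] := phi_smooth j.
Qed.
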